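(* Let $Y$ be a real topological vector space, $F\subseteq Y$, $a\in Y$, let $H$ be a proper closed subset of $Y$ and $k\in 0^+H\setminus\{0\}$. Assume, additionally, $0\in H$ and $H+H\subseteq H$. (a) $(P_{F,a,H,k})$ has an optimal solution if and only if $(P_{F+H,a,H,k})$ has an optimal solution. In this case, both optimal values coincide. Moreover, $$M_{F,a,H,k}\subseteq M_{F+H,a,H,k}\subseteq M_{F,a,H,k}+H.$$ (b) If $F+H$ is closed, then $$\operatorname{cl}M_{F,a,H,k}\subseteq M_{F,a,H,k}+H\quad\text{and}\quad \operatorname{Eff}(\operatorname{cl}M_{F,a,H,k},H)\subseteq\operatorname{Eff}(M_{F,a,H,k},H).$$ If, moreover, $H\cap(-H)=\{0\}$ holds, then $$\operatorname{Eff}(\operatorname{cl}M_{F,a,H,k},H)=\operatorname{Eff}(M_{F,a,H,k},H).$$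
   Context: For $A\subseteq Y$, the recession cone is $0^+A:=\{u\in Y\mid A+\mathbb{R}_+u\subseteq A\}$, where $\mathbb{R}_+=[0,\infty)$. A proper subset of $Y$ is a nonempty subset different from $Y$. $\operatorname{cl}$ denotes the topological closure. For $G\subseteq Y$, $(P_{G,a,H,k})$ is the problem of minimizing $t$ over all pairs $(y,t)\in G\times\mathbb{R}$ with $y\in a-H+tk$ (the feasible solutions). $M_{G,a,H,k}$ is the set of its optimal solutions $y$, i.e. of all $y\in G$ for which there is $t\in\mathbb{R}$ such that $(y,t)$ is feasible and $t\le s$ for every feasible $(z,s)$; this $t$ is the optimal value. For $G,D\subseteq Y$, the set of efficient elements of $G$ with respect to $D$ is $\operatorname{Eff}(G,D):=\{y^0\in G\mid G\cap(y^0-D)\subseteq\{y^0\}\}$. *)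

(* Defs.v *)
From mathcomp Require Import all_boot all_order all_algebra.
From mathcomp Require Import all_classical all_reals all_analysis.

Set Implicit Arguments.
Unset Strict Implicit.
Unset Printing Implicit Defensive.

Import Order.TTheory GRing.Theory Num.Theory.
Import numFieldNormedType.Exports.

Local Open Scope classical_set_scope.
Local Open Scope ring_scope.

(** A real topological vector space is a
    [topologicalLmodType R] with [R : realType]; [tvsType] would add local
    convexity. *)

Definition minkowski_sum (Y : zmodType) (A B : set Y) : set Y :=
  [set x + y | x in A & y in B].

Definition recession_cone (R : realType) (Y : lmodType R) (A : set Y) : set Y :=
  [set u | minkowski_sum A [set l *: u | l in [set l : R | 0 <= l]] `<=` A].

Definition proper_subset (T : Type) (A : set T) : Prop :=
  A !=set0 /\ A <> setT.

Section scalarization.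
Variables (R : realType) (Y : lmodType R).
Implicit Types (G H : set Y) (a k y : Y) (t : R).

Definition feasible G a H k : set (Y * R) :=
  [set p | G p.1 /\ [set a - h + p.2 *: k | h in H] p.1].

Definition optimal_pair G a H k : set (Y * R) :=
  [set p | feasible G a H k p /\
           forall q : Y * R, feasible G a H k q -> p.2 <= q.2].

Definition optimal_solutions G a H k : set Y :=
  [set y | exists t, optimal_pair G a H k (y, t)].

(** A relation rather than a function: the problem need not have an optimal
    value. *)
Definition is_optimal_value G a H k t : Prop :=
  exists y, optimal_pair G a H k (y, t).

End scalarization.

Definition Eff (Y : zmodType) (G D : set Y) : set Y :=
  [set y0 | G y0 /\ G `&` [set y0 - d | d in D] `<=` [set y0]].

(* Main.v *)
(** Adding [H] to [F] does not change the set of feasible values [t]: if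
    [f + h] lies in [a - H + t *: k] then so does [f], because [H] absorbs
    [H]. This gives (a). For (b), [M_{F+H}] is the slice of [F + H] by
    [a - H + t *: k] at the optimal value [t], hence closed, so that
    [M_F `<=` closure M_F `<=` M_{F+H} `<=` M_F + H]; any set squeezed between
    [M_F] and [M_F + H] has its efficient elements in [M_F]. *)

Require Import Defs.
From mathcomp Require Import all_boot all_order all_algebra.
From mathcomp Require Import all_classical all_reals all_analysis.

Set Implicit Arguments.
Unset Strict Implicit.
Unset Printing Implicit Defensive.

Import Order.TTheory GRing.Theory Num.Theory.
Import numFieldNormedType.Exports.

Local Open Scope classical_set_scope.
Local Open Scope ring_scope.

Section feasible_pairs.
Variables (R : realType) (Y : lmodType R) (F H : set Y) (a k : Y).

(** Solving [y = a - h + t *: k] for [h] removes the existential. *)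
Lemma feasibleE (G : set Y) (y : Y) (t : R) :
  feasible G a H k (y, t) <-> G y /\ H (a + t *: k - y).
Proof.
split=> -[/= Gy].
  by move=> [h Hh hy]; split=> //; rewrite -hy (addrAC a (- h)) subKr.
by move=> Hy; split=> //; exists (a + t *: k - y); rewrite //= addrAC subKr.
Qed.

Hypotheses (H0 : H 0) (HH : minkowski_sum H H `<=` H).

Lemma feasible_addr (y : Y) (t : R) :
  feasible F a H k (y, t) -> feasible (minkowski_sum F H) a H k (y, t).
Proof.
move=> /feasibleE[Fy Hy]; apply/feasibleE; split=> //.
by exists y => //; exists 0 => //; rewrite addr0.
Qed.

Lemma feasible_subr (f h : Y) (t : R) : F f -> H h ->
  feasible (minkowski_sum F H) a H k (f + h, t) -> feasible F a H k (f, t).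
Proof.
move=> Ff Hh /feasibleE[_ Hfh]; apply/feasibleE; split=> //; apply: HH.
(* The element of [H] witnessing [f] is the one witnessing [f + h], plus [h]. *)
by exists (a + t *: k - (f + h)) => //; exists h => //; rewrite opprD addrA subrK.
Qed.

(** Any competitor [f + h] in the enlarged problem yields the competitor [f] in the original one at
    the same value, so it cannot beat [t]. *)
Lemma optimal_pair_addr (y : Y) (t : R) :
  optimal_pair F a H k (y, t) -> optimal_pair (minkowski_sum F H) a H k (y, t).
Proof.
move=> [yt tmin]; split; first exact: feasible_addr.
move=> [z s] zs; have [[f Ff [h Hh fhz]] _] := zs.
by apply: (tmin (f, s)); apply: (feasible_subr Ff Hh); rewrite fhz.
Qed.

Lemma optimal_pair_subr (f h : Y) (t : R) : F f -> H h ->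
  optimal_pair (minkowski_sum F H) a H k (f + h, t) ->
  optimal_pair F a H k (f, t).
Proof.
move=> Ff Hh [fht tmin]; split; first exact: feasible_subr fht.
by move=> [z s] zs; apply: (tmin (z, s)); exact: feasible_addr.
Qed.

Lemma optimal_solutions_addr :
  optimal_solutions F a H k `<=` optimal_solutions (minkowski_sum F H) a H k.
Proof. by move=> y [t /optimal_pair_addr ?]; exists t. Qed.

Lemma optimal_solutions_subr :
  optimal_solutions (minkowski_sum F H) a H k `<=`
  minkowski_sum (optimal_solutions F a H k) H.
Proof.
move=> y [t yt]; have [[[/= f Ff [h Hh fhy]] _] _] := yt.
exists f; last by exists h.
by exists t; apply: (optimal_pair_subr Ff Hh); rewrite fhy.
Qed.

End feasible_pairs.

Lemma is_optimal_value_unique (R : realType) (Y : lmodType R) (G H : set Y)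
    (a k : Y) (s t : R) :
  is_optimal_value G a H k s -> is_optimal_value G a H k t -> s = t.
Proof.
move=> [y [ys smin]] [z [zt tmin]]; apply/eqP; rewrite eq_le.
by rewrite (smin _ zt) (tmin _ ys).
Qed.

(** Since the optimal value is unique, a point is optimal as soon as it is feasible at [t]; fixing
    [t] removes the quantifier over values. *)
Lemma optimal_solutions_slice (R : realType) (Y : lmodType R) (G H : set Y)
    (a k : Y) (t : R) : is_optimal_value G a H k t ->
  optimal_solutions G a H k = G `&` [set y | H (a + t *: k - y)].
Proof.
move=> tval; apply/seteqP; split=> y /=.
  move=> [s ys]; have -> : t = s.
    by apply: is_optimal_value_unique tval _; exists y.
  by have [/feasibleE] := ys.
move=> Gy; exists t; split; first exact/feasibleE.
by have [z [_ tmin]] := tval.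
Qed.

Lemma closed_optimal_solutions (R : realType) (Y : topologicalLmodType R)
    (G H : set Y) (a k : Y) :
  closed G -> closed H -> closed (optimal_solutions G a H k).
Proof.
move=> Gc Hc.
(* Without an optimal solution there is no value to slice at, but then the set is empty. *)
have [[y [t yt]]|/set0P/negP/negPn/eqP ->] :=
  pselect (optimal_solutions G a H k !=set0); last exact: closed0.
rewrite (@optimal_solutions_slice _ _ _ _ _ _ t); last by exists y.
(* The slice is the preimage of [H] under [y |-> a + t *: k - y], which is subtraction after pairing
   with a constant. *)
apply: closedI => //; apply: (preimage_closed _ Hc) => z _.
apply: (@continuous_comp _ _ _ (fun u => (a + t *: k, u))
  (fun x : Y * Y => x.1 - x.2)); last exact: sub_continuous.
by apply: cvg_pair; [exact: cvg_cst|exact: cvg_id].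
Qed.

Section squeezed_efficient_elements.
Variables (Y : zmodType) (M C H : set Y).
Hypotheses (MC : M `<=` C) (CMH : C `<=` minkowski_sum M H).

(** Writing an efficient [y] of [C] as [m + h] puts [m] in [C] and in [y - H], which forces
    [m = y]. *)
Lemma Eff_squeeze : Eff C H `<=` Eff M H.
Proof.
move=> y [Cy ymin]; have [m Mm [h Hh mhy]] := CMH Cy.
have my : m = y.
  by apply: ymin; split; [exact: MC|exists h; rewrite // -mhy addrK].
split; first by rewrite -my.
by move=> z [/MC Cz yz]; exact: ymin.
Qed.

Lemma Eff_squeeze_pointed : minkowski_sum H H `<=` H ->
  H `&` -%R @` H = [set 0] -> Eff C H = Eff M H.
Proof.
move=> HH Hpointed; apply/seteqP; split; first exact: Eff_squeeze.
move=> y [My ymin]; split; first exact: MC.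
move=> z [Cz [d Hd dz]]; have [m Mm [h Hh mh]] := CMH Cz.
(* Here [m = y - (d + h)] with [d + h] in [H], so efficiency of [y] in [M] applies. It gives
   [h = - d], and pointedness then kills [d]. *)
have my : m = y.
  apply: ymin; split=> //; exists (d + h).
    by apply: HH; exists d => //; exists h.
  by rewrite opprD addrA dz -mh addrK.
have hd : - h = d.
  by apply: oppr_inj; rewrite opprK; apply: (addrI y); rewrite dz -mh my.
have : (H `&` -%R @` H) d by split=> //; exists h.
by rewrite Hpointed /= -dz => ->; rewrite subr0.
Qed.

End squeezed_efficient_elements.

Theorem proposition1 (R : realType) (Y : topologicalLmodType R)
    (F : set Y) (a : Y) (H : set Y) (k : Y)
    (H_proper : proper_subset H) (H_closed : closed H)
    (k_rec : (recession_cone H `\ 0) k)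
    (H0 : H 0) (HH : minkowski_sum H H `<=` H) :
  let FH := minkowski_sum F H in
  let M := optimal_solutions F a H k in
  let MH := optimal_solutions FH a H k in
  ((M !=set0 <-> MH !=set0) /\
   (forall t t' : R, is_optimal_value F a H k t ->
      is_optimal_value FH a H k t' -> t = t') /\
   M `<=` MH /\ MH `<=` minkowski_sum M H)
  /\
  (closed FH ->
   closure M `<=` minkowski_sum M H /\
   Eff (closure M) H `<=` Eff M H /\
   (H `&` -%R @` H = [set 0] -> Eff (closure M) H = Eff M H)).
Proof.
move=> FH M MH.
have M_MH : M `<=` MH by exact: optimal_solutions_addr.
have MH_MH : MH `<=` minkowski_sum M H by exact: optimal_solutions_subr.
split.
  split; first split.
  - by move=> [y /M_MH]; exists y.
  - by move=> [y /MH_MH[m Mm _]]; exists m.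
  (* The same [y] makes [t] an optimal value for [FH], where optimal values are unique. *)
  split=> // t t' [y /(optimal_pair_addr H0 HH) yt].
  by apply: is_optimal_value_unique; exists y.
move=> FHc; have clM : closure M `<=` minkowski_sum M H.
  (* The closure lies in every closed superset of [M], and [MH] is one. *)
  apply: (subset_trans _ MH_MH); rewrite closureE => y; apply.
  by split=> //; exact: closed_optimal_solutions.
have M_clM := @subset_closure _ M.
split=> //; split; first exact: Eff_squeeze.
exact: Eff_squeeze_pointed.
Qed.
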